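(* Let $R$ be a (cut-free) $\mathsf{MLL}$ proof-structure and let $F$, $F'$ be two formula occurrences in $R$. Then $\{\pi|_\mathbf{J} \mid \pi\in\mathsf{seq}(\mathbf{J}_{F\to F'}(R))\} = \mathsf{seq}_{(F,F')}(R)$. Equivalently, applying $\mathbf{J}_{F\to F'}(\cdot)$, then taking sequentializations, then erasing $\mathbf{J}$ (pointwise), coincides with $\mathsf{seq}_{(F,F')}(\cdot)$.
   Context: $\mathsf{MLL}$ proof-structures are graphs built from axiom, tensor ($\otimes$), par ($⅋$) and cut links. For a proof-structure $R$, $\mathsf{seq}(R)$ denotes the set of sequent calculus proofs whose desequentialization is $R$. Its elements are in bijection rule-by-link with $R$, so edges correspond to formula occurrences. In a proof $\pi$, $F$ is above $F'$ (written $F>_\pi F'$) if the rule creating $F$ lies on the same branch as, and above, the rule using $F'$. For a set $\mathcal{L}$ of pairs of formula occurrences, $\mathsf{seq}_\mathcal{L}(R)=\{\pi\in\mathsf{seq}(R)\mid \forall (F,F')\in\mathcal{L}, F>_\pi F'\}$. $\mathbf{J}$ is a special atom. $\mathbf{J}_{F\to F'}(R)$ is obtained from $R$ by grafting a jump gadget, with types propagated downward. The gadget consists of an axiom link with conclusions $\mathbf{J},\mathbf{J}^\perp$, a $\otimes$ link with premises $F,\mathbf{J}$ (conclusion $F\otimes\mathbf{J}$) placed where $F$ is, and a ⅋ link with premises $F',\mathbf{J}^\perp$ (conclusion $\mathbf{J}^\perp⅋F'$) placed where $F'$ is. The result is a proof-structure of $\mathsf{MLL}_\mathbf{J}$. This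 is the cut-free $\mathsf{MLL}$ extended by the rule deriving $\vdash\Gamma,F\otimes\mathbf{J},\mathbf{J}^\perp,\Theta_\mathbf{J}$ from $\vdash\Gamma,F,\Theta_\mathbf{J}$ and axiom $\vdash\mathbf{J},\mathbf{J}^\perp$, and the rule deriving $\vdash\Gamma,F⅋\mathbf{J}^\perp,\Theta_\mathbf{J}$ from $\vdash\Gamma,F,\mathbf{J}^\perp,\Theta_\mathbf{J}$. In both rules $F$ is neither $\mathbf{J}$ nor $\mathbf{J}^\perp$, and $\Theta_\mathbf{J}$ consists of $\mathbf{J}$, $\mathbf{J}^\perp$. $\pi|_\mathbf{J}$ is the erasure of $\mathbf{J}$ from an $\mathsf{MLL}_\mathbf{J}$ proof: these two special rules and the $\mathbf{J}$ axioms are deleted, and formulas $G\otimes\mathbf{J}$, $G⅋\mathbf{J}^\perp$ are replaced by the erasure of $G$.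
   Formalization: ''F above F''' is mended: the rule creating F must lie over the premise containing F' of the rule using F' (not over the other premise of a tensor), and a conclusion F' of the proof counts as used at the root; with the literal definition the equality fails. *)

(* Defs.v *)
From HB Require Import structures.
From mathcomp Require Import all_boot.
From mathcomp Require Import boolp classical_sets.

Set Implicit Arguments.
Unset Strict Implicit.
Unset Printing Implicit Defensive.

Local Open Scope classical_set_scope.

Inductive formula (X : Type) : Type :=
| Var (a : X)
| Covar (a : X)
| FTens (A B : formula X)
| FPar (A B : formula X).

Fixpoint dual (X : Type) (A : formula X) : formula X :=
  match A with
  | Var a => Covar a
  | Covar a => Var a
  | FTens A B => FPar (dual A) (dual B)
  | FPar A B => FTens (dual A) (dual B)
  end.

(* Formulas of MLL_J are formulas over [option X]; the special atom is [None]. *)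
Definition J (X : Type) : formula (option X) := Var None.
Definition Jd (X : Type) : formula (option X) := Covar None.
Arguments J {X}.
Arguments Jd {X}.

Definition is_J (X : Type) (A : formula (option X)) : bool :=
  match A with Var None | Covar None => true | _ => false end.

Fixpoint embed (X : Type) (A : formula X) : formula (option X) :=
  match A with
  | Var a => Var (Some a)
  | Covar a => Covar (Some a)
  | FTens A B => FTens (embed A) (embed B)
  | FPar A B => FPar (embed A) (embed B)
  end.

(* Edges, i.e. formula occurrences, are named by natural numbers.  An axiom    *)
(* link carries the type [A] of its first conclusion, the second one having    *)
(* type [dual A]; as there are no cuts, the types of all other edges are       *)
(* obtained from these by propagating downward (see [well_typed]).             *)
Inductive link (X : Type) : Type :=
| LAx (p q : nat) (A : formula X)
| LTens (p q r : nat)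
| LPar (p q r : nat).
Arguments LTens {X} p q r.
Arguments LPar {X} p q r.

Lemma formula_comparable (X : eqType) : comparable (formula X).
Proof. by move=> x y; rewrite /decidable; decide equality; apply: eq_comparable. Qed.
HB.instance Definition _ (X : eqType) :=
  hasDecEq.Build (formula X) (compareP (@formula_comparable X)).

Lemma link_comparable (X : eqType) : comparable (link X).
Proof. by move=> x y; rewrite /decidable; decide equality; apply: eq_comparable. Qed.
HB.instance Definition _ (X : eqType) :=
  hasDecEq.Build (link X) (compareP (@link_comparable X)).

Definition link_prem (X : Type) (l : link X) : seq nat :=
  match l with
  | LAx _ _ _ => [::]
  | LTens p q _ | LPar p q _ => [:: p; q]
  end.

Definition link_concl (X : Type) (l : link X) : seq nat :=
  match l with
  | LAx p q _ => [:: p; q]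
  | LTens _ _ r | LPar _ _ r => [:: r]
  end.

(* Finite families of links, to be compared up to [perm_eq]. *)
Definition graph (X : Type) := seq (link X).

Definition edges (X : Type) (R : graph X) : seq nat :=
  flatten [seq link_concl l | l <- R].

Definition premises (X : Type) (R : graph X) : seq nat :=
  flatten [seq link_prem l | l <- R].

Definition conclusions (X : Type) (R : graph X) : seq nat :=
  [seq e <- edges R | e \notin premises R].

Definition well_typed (X : Type) (ty : nat -> formula X) (l : link X) : Prop :=
  match l with
  | LAx p q A => ty p = A /\ ty q = dual A
  | LTens p q r => ty r = FTens (ty p) (ty q)
  | LPar p q r => ty r = FPar (ty p) (ty q)
  end.

(* Each edge is the conclusion of exactly one link and a premise of at most    *)
(* one, and the edges can be coherently labelled by formulas.                  *)
Definition proof_structure (X : eqType) (R : graph X) : Prop :=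
  [/\ uniq (edges R), uniq (premises R), {subset premises R <= edges R} &
      exists ty : nat -> formula X, forall l, l \in R -> well_typed ty l].

(* Sequent calculus proofs of cut-free MLL.  A rule mentions the occurrences   *)
(* it uses and creates; the sequents are recovered by [mll].                   *)
Inductive proof (X : Type) : Type :=
| Ax (p q : nat) (A : formula X)
| Tens (pi1 pi2 : proof X) (p q r : nat)
| Par (pi : proof X) (p q r : nat).

Definition sequent (X : Type) := seq (nat * formula X).

Inductive mll (X : eqType) : proof X -> sequent X -> Prop :=
| mll_ax p q A :
    mll (Ax p q A) [:: (p, A); (q, dual A)]
| mll_tens pi1 pi2 p q r A B Gamma Delta :
    mll pi1 ((p, A) :: Gamma) -> mll pi2 ((q, B) :: Delta) ->
    mll (Tens pi1 pi2 p q r) ((r, FTens A B) :: Gamma ++ Delta)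
| mll_par pi p q r A B Gamma :
    mll pi [:: (p, A), (q, B) & Gamma] ->
    mll (Par pi p q r) ((r, FPar A B) :: Gamma)
| mll_exchange pi Gamma Delta :
    perm_eq Gamma Delta -> mll pi Gamma -> mll pi Delta.

Definition last_link (X : Type) (pi : proof X) : link X :=
  match pi with
  | Ax p q A => LAx p q A
  | Tens _ _ p q r => LTens p q r
  | Par _ p q r => LPar p q r
  end.

Definition subproof (X : Type) (sigma tau : proof X) : Prop :=
  match tau with
  | Ax _ _ _ => False
  | Tens pi1 pi2 _ _ _ => sigma = pi1 \/ sigma = pi2
  | Par pi1 _ _ _ => sigma = pi1
  end.

Fixpoint deseq (X : Type) (pi : proof X) : graph X :=
  last_link pi :: match pi with
  | Ax _ _ _ => [::]
  | Tens pi1 pi2 _ _ _ => deseq pi1 ++ deseq pi2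
  | Par pi1 _ _ _ => deseq pi1
  end.

(* [perm_eq] makes rules of the proof and links of the graph correspond        *)
(* bijectively; for a proof-structure [R] it also forces distinct occurrences  *)
(* of the proof to bear distinct names.                                        *)
Definition seqn (X : eqType) (R : graph X) : set (proof X) :=
  [set pi | (exists Gamma, mll pi Gamma) /\ perm_eq (deseq pi) R].

(* Rules of [pi] are identified with the subproofs [sigma] they end. *)
Inductive rule_of (X : Type) (sigma : proof X) : proof X -> Prop :=
| rule_of_last : rule_of sigma sigma
| rule_of_sub tau pi : rule_of sigma tau -> subproof tau pi -> rule_of sigma pi.

Definition creates (X : Type) (sigma : proof X) (F : nat) : Prop :=
  F \in link_concl (last_link sigma).

Definition uses (X : Type) (tau : proof X) (F' : nat) : Prop :=
  F' \in link_prem (last_link tau).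

(* The rule [sigma] creating [F] is strictly above the rule [tau] using [F'],  *)
(* on the branch of [F']: when [tau] is a tensor rule, [sigma] has to lie over *)
(* the premise [rho] of [tau] whose conclusion contains [F'], not over the     *)
(* other one.  A conclusion [F'] of [pi] is used by no rule; it counts as used *)
(* at the root, below all the rules of [pi].                                   *)
Definition above (X : Type) (pi : proof X) (F F' : nat) : Prop :=
  exists2 sigma, creates sigma F &
    (rule_of sigma pi /\ F' \in conclusions (deseq pi)) \/
    exists tau rho, [/\ rule_of tau pi, uses tau F', subproof rho tau,
      F' \in conclusions (deseq rho) & rule_of sigma rho].

Definition seqn_above (X : eqType) (L : set (nat * nat)) (R : graph X) :
    set (proof X) :=
  [set pi | seqn R pi /\ forall F F', L (F, F') -> above pi F F'].

(* MLL_J.  [JTens pi p j j' r] is the rule which tensors the occurrence [p]    *)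
(* with the conclusion [j] of an axiom introducing [j : J] and [j' : J^\perp]. *)
Inductive proofJ (X : Type) : Type :=
| JAx (p q : nat) (A : formula X)
| JMTens (pi1 pi2 : proofJ X) (p q r : nat)
| JMPar (pi : proofJ X) (p q r : nat)
| JTens (pi : proofJ X) (p j j' r : nat)
| JPar (pi : proofJ X) (p j' r : nat).

Inductive mllJ (X : eqType) : proofJ X -> sequent (option X) -> Prop :=
| mllJ_ax p q A :
    mllJ (JAx p q A) [:: (p, embed A); (q, dual (embed A))]
| mllJ_mtens pi1 pi2 p q r A B Gamma Delta :
    ~~ is_J A -> ~~ is_J B ->
    mllJ pi1 ((p, A) :: Gamma) -> mllJ pi2 ((q, B) :: Delta) ->
    mllJ (JMTens pi1 pi2 p q r) ((r, FTens A B) :: Gamma ++ Delta)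
| mllJ_mpar pi p q r A B Gamma :
    ~~ is_J A -> ~~ is_J B ->
    mllJ pi [:: (p, A), (q, B) & Gamma] ->
    mllJ (JMPar pi p q r) ((r, FPar A B) :: Gamma)
| mllJ_jtens pi p j j' r A Gamma :
    ~~ is_J A ->
    mllJ pi ((p, A) :: Gamma) ->
    mllJ (JTens pi p j j' r) [:: (r, FTens A J), (j', Jd) & Gamma]
| mllJ_jpar pi p j' r A Gamma :
    ~~ is_J A ->
    mllJ pi [:: (p, A), (j', Jd) & Gamma] ->
    mllJ (JPar pi p j' r) ((r, FPar A Jd) :: Gamma)
| mllJ_exchange pi Gamma Delta :
    perm_eq Gamma Delta -> mllJ pi Gamma -> mllJ pi Delta.

Fixpoint deseqJ (X : Type) (pi : proofJ X) : graph (option X) :=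
  match pi with
  | JAx p q A => [:: LAx p q (embed A)]
  | JMTens pi1 pi2 p q r => LTens p q r :: deseqJ pi1 ++ deseqJ pi2
  | JMPar pi1 p q r => LPar p q r :: deseqJ pi1
  | JTens pi1 p j j' r => [:: LTens p j r, LAx j j' J & deseqJ pi1]
  | JPar pi1 p j' r => LPar p j' r :: deseqJ pi1
  end.

Definition seqnJ (X : eqType) (R : graph (option X)) : set (proofJ X) :=
  [set pi | (exists Gamma, mllJ pi Gamma) /\ perm_eq (deseqJ pi) R].

(* Erasure turns the conclusion of a jump rule into its non-J premise:         *)
(* [origin pi e] is the occurrence that [e] becomes.                           *)
Fixpoint origin (X : Type) (pi : proofJ X) (e : nat) : nat :=
  match pi with
  | JAx _ _ _ => e
  | JMTens pi1 pi2 _ _ _ => origin pi1 (origin pi2 e)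
  | JMPar pi1 _ _ _ => origin pi1 e
  | JTens pi1 p _ _ r => origin pi1 (if e == r then p else e)
  | JPar pi1 p _ r => origin pi1 (if e == r then p else e)
  end.

Fixpoint erase (X : Type) (pi : proofJ X) : proof X :=
  match pi with
  | JAx p q A => Ax p q A
  | JMTens pi1 pi2 p q r =>
      Tens (erase pi1) (erase pi2) (origin pi1 p) (origin pi2 q) r
  | JMPar pi1 p q r => Par (erase pi1) (origin pi1 p) (origin pi1 q) r
  | JTens pi1 _ _ _ _ => erase pi1
  | JPar pi1 _ _ _ => erase pi1
  end.

(* Proofs do not record formulas except in axioms, and those of MLL_J contain  *)
(* no J.  The sequents of an erased proof are the erasures of the original     *)
(* ones, in the following sense (see [erase_sound]).                           *)
Fixpoint erase_formula (X : Type) (A : formula (option X)) :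
    option (formula X) :=
  match A with
  | Var a => omap (@Var X) a
  | Covar a => omap (@Covar X) a
  | FTens A B =>
      match erase_formula A, erase_formula B with
      | Some A', Some B' => Some (FTens A' B')
      | Some C, None | None, Some C => Some C
      | None, None => None
      end
  | FPar A B =>
      match erase_formula A, erase_formula B with
      | Some A', Some B' => Some (FPar A' B')
      | Some C, None | None, Some C => Some C
      | None, None => None
      end
  end.

Definition erase_sequent (X : Type) (pi : proofJ X)
    (Gamma : sequent (option X)) : sequent X :=
  pmap (fun x => omap (pair (origin pi x.1)) (erase_formula x.2)) Gamma.

Definition embed_link (X : Type) (l : link X) : link (option X) :=
  match l with
  | LAx p q A => LAx p q (embed A)
  | LTens p q r => LTens p q r
  | LPar p q r => LPar p q r
  end.

Definition reroute (X : Type) (e e' : nat) (l : link X) : link X :=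
  let s x := if x == e then e' else x in
  match l with
  | LAx p q A => LAx p q A
  | LTens p q r => LTens (s p) (s q) r
  | LPar p q r => LPar (s p) (s q) r
  end.

Definition fresh (X : Type) (R : graph X) : nat := (\max_(e <- edges R) e).+1.

(* The par is grafted first, so that for [F = F'] the tensor comes above it:   *)
(* [F] is then replaced by [(F (x) J) par J^\perp].                            *)
Definition jump (X : Type) (F F' : nat) (R : graph X) : graph (option X) :=
  let j := fresh R in
  let j' := j.+1 in
  let t := j.+2 in
  let u := j.+3 in
  let R1 := LPar F' j' u :: map (reroute F' u) (map (@embed_link X) R) in
  [:: LAx j j' J, LTens F j t & map (reroute F t) R1].

Arguments erase_sequent : simpl never.

Lemma edges_cat (Y : Type) (R S : graph Y) : edges (R ++ S) = edges R ++ edges S.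
Proof. by rewrite /edges map_cat flatten_cat. Qed.

Lemma edges_cons (Y : Type) l (R : graph Y) : edges (l :: R) = link_concl l ++ edges R.
Proof. by []. Qed.

Lemma origin_out (X : eqType) (pi : proofJ X) e : e \notin edges (deseqJ pi) -> origin pi e = e.
Proof.
elim: pi e => [p q A|pi1 IH1 pi2 IH2 p q r|pi IH p q r|pi IH p j j' r|pi IH p j r] e //=;
  rewrite ?edges_cons ?edges_cat /= ?in_cons ?mem_cat ?negb_or.
- by case/and3P=> _ h1 h2; rewrite IH2 // IH1.
- by case/andP=> _ /IH.
- by case/and4P=> /negPf -> _ _ /IH.
- by case/andP=> /negPf -> /IH.
Qed.

Lemma mllJ_edges (X : eqType) (pi : proofJ X) Gamma : mllJ pi Gamma ->
  {subset map fst Gamma <= edges (deseqJ pi)}.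
Proof.
elim => { pi Gamma} [p q A|pi1 pi2 p q r A B G D _ _ _ IH1 _ IH2|pi p q r A B G _ _ _ IH|pi p j j' r A G _ _ IH|pi p j r A G _ _ IH|pi G D GD _ IH] e;
  rewrite ?edges_cons ?edges_cat /= ?map_cat ?in_cons ?mem_cat //.
- case/or3P=> [-> //|h|h].
    by rewrite IH1 ?orbT //= in_cons h orbT.
  by rewrite IH2 ?orbT //= in_cons h orbT.
- by case/orP=> [-> //|h]; rewrite IH ?orbT //= !in_cons h !orbT.
- case/or3P=> [-> //|-> |h]; rewrite ?orbT //.
  by rewrite IH ?orbT //= in_cons h orbT.
- by case/orP=> [-> //|h]; rewrite IH ?orbT //= !in_cons h !orbT.
- by rewrite -(perm_mem (perm_map fst GD)) => /IH.
Qed.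

Lemma origin_in (X : eqType) (pi : proofJ X) Gamma e : mllJ pi Gamma ->
  e \in edges (deseqJ pi) -> uniq (edges (deseqJ pi)) -> origin pi e \in edges (deseqJ pi).
Proof.
move=> H; elim: H e => { pi Gamma} [p q A|pi1 pi2 p q r A B G D _ _ _ IH1 _ IH2|pi p q r A B G _ _ _ IH|pi p j j' r A G _ H IH|pi p j r A G _ H IH|pi G D GD _ IH] e //;
  rewrite ?edges_cons ?edges_cat /= ?in_cons ?mem_cat.
- move=> he /andP[]; rewrite negb_or => /andP[n1 n2].
  rewrite cat_uniq => /and3P[u1 /hasPn dis u2].
  case/or3P: he => [/eqP -> |h|h].
  + by rewrite !origin_out // eqxx.
  + by rewrite [origin pi2 e]origin_out ?IH1 ?orbT //; apply/negP=> /dis; rewrite h.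
  + by have h2 := IH2 _ h u2; rewrite [origin pi1 _]origin_out ?h2 ?orbT //; apply: dis.
- by move=> + /andP[n1 u]; case/orP=> [/eqP -> |h]; [rewrite origin_out ?eqxx | rewrite IH ?orbT].
- have := mllJ_edges H; move/(_ p); rewrite /= in_cons eqxx => /(_ isT) hp.
  move=> + /and4P[n1 n2 n3 u]; case: eqP => [_ _|/= _]; first by rewrite IH ?orbT.
  move: n1 n2; rewrite !negb_or => n1 n2.
  case/or3P=> [/eqP -> |/eqP -> |h]; last by rewrite IH ?orbT.
  + by rewrite origin_out ?eqxx ?orbT //; case/andP: n2.
  + by rewrite origin_out ?eqxx ?orbT //.
- have := mllJ_edges H; move/(_ p); rewrite /= in_cons eqxx => /(_ isT) hp.
  move=> + /andP[n1 u]; case: eqP => [_ _|/= _]; first by rewrite IH ?orbT.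
  by move=> h; rewrite IH ?orbT.
- exact: IH.
Qed.

Lemma erase_embed (X : eqType) (A : formula X) : erase_formula (embed A) = Some A.
Proof. by elim: A => //= A -> B ->. Qed.

Lemma dual_embed (X : eqType) (A : formula X) : dual (embed A) = embed (dual A).
Proof. by elim: A => //= A -> B ->. Qed.

Lemma mllJ_formulas (X : eqType) (pi : proofJ X) Gamma : mllJ pi Gamma ->
  all (fun x : nat * formula (option X) => is_J x.2 == ~~ erase_formula x.2) Gamma.
Proof.
elim => { pi Gamma} [p q A|pi1 pi2 p q r A B G D nA nB _ IH1 _ IH2|pi p q r A B G nA nB _ IH|pi p j j' r A G nA _ IH|pi p j r A G nA _ IH|pi G D GD _ IH] /=.
- by rewrite dual_embed !erase_embed; case: A => //= a; rewrite eqxx.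
- rewrite all_cat; move: IH1 IH2 => /= /andP[+ ->] /andP[+ ->].
  by rewrite (negPf nA) (negPf nB); do 2!case: erase_formula.
- move: IH => /= /and3P[+ + ->].
  by rewrite (negPf nA) (negPf nB); do 2!case: erase_formula.
- move: IH => /= /andP[+ ->].
  by rewrite (negPf nA); case: erase_formula.
- move: IH => /= /andP[+ ->].
  by rewrite (negPf nA); case: erase_formula.
- by rewrite -(perm_all _ GD).
Qed.

Lemma erase_sequent_eq (X : eqType) (pi pi' : proofJ X) (G : sequent (option X)) :
  {in map fst G, origin pi =1 origin pi'} -> erase_sequent pi G = erase_sequent pi' G.
Proof.
elim: G => //= -[e A] G IH h /=; rewrite /erase_sequent /= h ?mem_head //.
have {}IH : erase_sequent pi G = erase_sequent pi' G.
  by apply: IH => x hx; apply: h; rewrite in_cons hx orbT.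
by rewrite /erase_sequent in IH; rewrite IH.
Qed.

Lemma mllJ_nonJ (X : eqType) (pi : proofJ X) Gamma p A : mllJ pi Gamma -> (p, A) \in Gamma -> ~~ is_J A ->
  exists A', erase_formula A = Some A'.
Proof.
move=> /mllJ_formulas /allP H /H /= /eqP -> ; rewrite negbK.
by case: erase_formula => // A' _; exists A'.
Qed.

Lemma erase_sequent_cons (X : eqType) (pi : proofJ X) e A A' (G : sequent (option X)) :
  erase_formula A = Some A' ->
  erase_sequent pi ((e, A) :: G) = (origin pi e, A') :: erase_sequent pi G.
Proof. by rewrite /erase_sequent /= => ->. Qed.

Lemma erase_sound (X : eqType) (pi : proofJ X) Gamma : uniq (edges (deseqJ pi)) -> mllJ pi Gamma ->
  mll (erase pi) (erase_sequent pi Gamma).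
Proof.
move=> + H; elim: H => { pi Gamma} [p q A|pi1 pi2 p q r A B G D nA nB H1 IH1 H2 IH2|pi p q r A B G nA nB H IH|pi p j j' r A G nA H IH|pi p j r A G nA H IH|pi G D GD _ IH] U.
- by rewrite /erase_sequent /= dual_embed !erase_embed; exact: mll_ax.
- have [A' eA] := mllJ_nonJ H1 (mem_head _ _) nA.
  have [B' eB] := mllJ_nonJ H2 (mem_head _ _) nB.
  move: U; rewrite edges_cons edges_cat /= mem_cat negb_or cat_uniq => /andP[/andP[n1 n2] /and3P[u1 /hasPn dis u2]].
  have := IH1 u1; have := IH2 u2.
  have s1 := mllJ_edges H1; have s2 := mllJ_edges H2.
  rewrite (erase_sequent_cons _ _ _ eA) (erase_sequent_cons _ _ _ eB) => h2 h1.
  rewrite (@erase_sequent_cons _ _ _ _ (FTens A' B')) /= ?eA ?eB // (origin_out n2) (origin_out n1).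
  rewrite {1}/erase_sequent pmap_cat -!/(erase_sequent _ _).
  rewrite (_ : erase_sequent _ G = erase_sequent pi1 G); last first.
    apply: erase_sequent_eq => e he /=; rewrite [origin pi2 e]origin_out //.
    by apply/negP => /dis; rewrite s1 //= in_cons he orbT.
  rewrite (_ : erase_sequent _ D = erase_sequent pi2 D); last first.
    apply: erase_sequent_eq => e he /=; rewrite [origin pi1 _]origin_out //.
    by apply: dis; apply: (origin_in H2) => //; apply: s2; rewrite /= in_cons he orbT.
  exact: mll_tens h1 h2.
- have [A' eA] := mllJ_nonJ H (mem_head _ _) nA.
  have Bin : (q, B) \in [:: (p, A), (q, B) & G] by rewrite !in_cons eqxx orbT.
  have [B' eB] := mllJ_nonJ H Bin nB.
  move: U; rewrite edges_cons /= => /andP[n u]; have := IH u.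
  rewrite (erase_sequent_cons _ _ _ eA) (erase_sequent_cons _ _ _ eB) => h.
  rewrite (@erase_sequent_cons _ _ _ _ (FPar A' B')) /= ?eA ?eB // (origin_out n).
  exact: mll_par h.
- have [A' eA] := mllJ_nonJ H (mem_head _ _) nA.
  move: U; rewrite !edges_cons /= => /and4P[n n1 n2 u]; have := IH u.
  have s := mllJ_edges H.
  rewrite (erase_sequent_cons _ _ _ eA) (@erase_sequent_cons _ _ _ _ A') /= ?eA ?eqxx //.
  rewrite (_ : erase_sequent _ (_ :: G) = erase_sequent pi G) //.
  transitivity (erase_sequent (JTens pi p j j' r) G) => //.
  apply: erase_sequent_eq => e he /=; case: eqP => // er.
  by move: n; rewrite -er !in_cons !negb_or s ?andbF //= in_cons he orbT.
- have [A' eA] := mllJ_nonJ H (mem_head _ _) nA.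
  move: U; rewrite !edges_cons /= => /andP[n u]; have := IH u.
  have s := mllJ_edges H.
  rewrite (erase_sequent_cons _ _ _ eA) (@erase_sequent_cons _ (JPar pi p j r) r _ A') /= ?eA ?eqxx //.
  rewrite (_ : erase_sequent (JPar _ _ _ _) G = erase_sequent pi G) //.
  apply: erase_sequent_eq => e he /=; case: eqP => // er.
  by move: n; rewrite -er s //= !in_cons he !orbT.
- by apply: mll_exchange (IH U); rewrite /erase_sequent; apply: perm_pmap.
Qed.

(* Main.v *)
Require Import Defs.
From mathcomp Require Import all_boot.
From mathcomp Require Import zify.
From mathcomp Require Import boolp classical_sets.
Set Implicit Arguments.
Unset Strict Implicit.
Unset Printing Implicit Defensive.
Local Open Scope classical_set_scope.

(** The par of the gadget can only be applied to a sequent that still contains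
    [J^\perp], hence below the tensor of the gadget, hence below the creation of
    [F]; and a rule using [F'] in the erased proof used the conclusion of that par.
    So the erasure of a sequentialization of the jump has [F] above [F'].
    Conversely, if [F] is above [F'], inserting the tensor immediately below the
    rule creating [F] and the par immediately above the rule using [F'] (or at the
    root) yields a sequentialization, as [J^\perp] is passed down from the former to
    the latter.  Proofs being cut-free, types never obstruct a rule except through
    the atom [J], whose occurrences are determined by the names of the edges; the
    argument is therefore carried out on untyped sequents. *)

(** * Lists, edges and premises *)

(** Lets an exchange on bare edge names be replayed on sequents that also carry formulas. *)
Lemma perm_map_lift (T U : eqType) (f : T -> U) s t :
  perm_eq t (map f s) -> exists2 s', perm_eq s' s & map f s' = t.
Proof.
case: s => [/perm_nilP -> |x0 s]; first by exists [::].
set s0 := x0 :: s; move=> /(perm_iotaP (f x0))[I pI ->].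
rewrite size_map in pI; exists [seq nth x0 s0 i | i <- I].
  apply: perm_trans (perm_map _ pI) _.
  by rewrite map_nth_iota0 ?take_size.
rewrite -map_comp; apply/eq_in_map => i iI.
rewrite (nth_map x0) //.
by have := perm_mem pI i; rewrite iI mem_iota.
Qed.

(** The additive form is the one needed to count links: without repetition, the indicator of a
    concatenation is the sum of the indicators. *)
Lemma mem_cat_disjoint (T : eqType) (s t : seq T) x : uniq (s ++ t) ->
  (x \in s ++ t) = (x \in s) + (x \in t) :> nat.
Proof.
rewrite cat_uniq mem_cat => /and3P[_ /hasPn dis _].
by have := dis x; case: (x \in s); case: (x \in t) => //= /(_ isT).
Qed.

Lemma edges_Tens (X : Type) (pi1 pi2 : proof X) p q r :
  edges (deseq (Tens pi1 pi2 p q r)) =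
  r :: edges (deseq pi1) ++ edges (deseq pi2).
Proof. by rewrite -edges_cat. Qed.

Lemma edges_Par (X : Type) (pi : proof X) p q r :
  edges (deseq (Par pi p q r)) = r :: edges (deseq pi).
Proof. by []. Qed.

Lemma premises_Tens (X : Type) (pi1 pi2 : proof X) p q r :
  premises (deseq (Tens pi1 pi2 p q r)) =
  [:: p, q & premises (deseq pi1) ++ premises (deseq pi2)].
Proof. by rewrite /premises /= map_cat flatten_cat. Qed.

Lemma premises_Par (X : Type) (pi : proof X) p q r :
  premises (deseq (Par pi p q r)) = [:: p, q & premises (deseq pi)].
Proof. by []. Qed.

Lemma edgesP (X : eqType) (R : graph X) e :
  reflect (exists2 l, l \in R & e \in link_concl l) (e \in edges R).
Proof. exact: flatten_mapP. Qed.

Lemma premisesP (X : eqType) (R : graph X) e :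
  reflect (exists2 l, l \in R & e \in link_prem l) (e \in premises R).
Proof. exact: flatten_mapP. Qed.

Lemma perm_edges (X : eqType) (R S : graph X) :
  perm_eq R S -> perm_eq (edges R) (edges S).
Proof. by move=> RS; apply/perm_flatten/perm_map. Qed.

Lemma embed_inj (X : eqType) : injective (@embed X).
Proof. by move=> A B /(congr1 (@erase_formula X)); rewrite !erase_embed => -[]. Qed.

(** * Formula occurrences above others *)

Section Above.
Context (X : eqType) (F F' : nat).
Implicit Types pi rho sigma tau : proof X.

(** Each rule moves its active occurrences from the sequent to the premises and adds the one or two
    edges it creates, so every edge is either used once or still in the sequent. *)
Lemma mll_edges pi Gamma : mll pi Gamma ->
  perm_eq (edges (deseq pi)) (premises (deseq pi) ++ map fst Gamma).
Proof.
elim=> { pi Gamma} [p q A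
  |pi1 pi2 p q r A B G D _ + _ +
  |pi p q r A B G _ +
  |pi G D GD _ IH] //.
- move=> /permP H1 /permP H2; apply/permP => a; move: (H1 a) (H2 a).
  rewrite edges_Tens premises_Tens.
  by rewrite !(count_cat, map_cons, map_cat) /= !count_cat; lia.
- move=> /permP H; apply/permP => a; move: (H a).
  rewrite edges_Par premises_Par.
  by rewrite !(count_cat, map_cons) /=; lia.
- by rewrite (permPl IH) perm_cat2l perm_map.
Qed.

Lemma premises_edges pi Gamma : mll pi Gamma ->
  {subset premises (deseq pi) <= edges (deseq pi)}.
Proof. by move=> /mll_edges/perm_mem E e; rewrite E mem_cat => ->. Qed.

Lemma sequent_edges pi Gamma : mll pi Gamma ->
  {subset map fst Gamma <= edges (deseq pi)}.
Proof. by move=> /mll_edges/perm_mem E e; rewrite E mem_cat orbC => ->. Qed.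

Lemma sequent_unused pi Gamma e : mll pi Gamma -> uniq (edges (deseq pi)) ->
  e \in map fst Gamma -> e \notin premises (deseq pi).
Proof.
move=> /mll_edges/perm_uniq ->; rewrite cat_uniq => /and3P[_ /hasPn + _].
exact.
Qed.

Lemma sequent_conclusions pi Gamma e : mll pi Gamma -> uniq (edges (deseq pi)) ->
  e \in map fst Gamma -> e \in conclusions (deseq pi).
Proof.
by move=> H U h; rewrite mem_filter (sequent_unused H U h) (sequent_edges H h).
Qed.

(* A recursive form of [above]: every use of [F'] has [F] over its premise. *)
Fixpoint jumpable pi : bool :=
  match pi with
  | Ax _ _ _ => true
  | Tens pi1 pi2 p q _ =>
      [&& jumpable pi1, jumpable pi2,
          (p == F') ==> (F \in edges (deseq pi1)) &
          (q == F') ==> (F \in edges (deseq pi2))]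
  | Par pi1 p q _ =>
      jumpable pi1 && ((F' \in [:: p; q]) ==> (F \in edges (deseq pi1)))
  end.

Lemma jumpable_unused pi : F' \notin premises (deseq pi) -> jumpable pi.
Proof.
elim: pi => [//|pi1 IH1 pi2 IH2 p q r|pi IH p q r];
  rewrite ?premises_Tens ?premises_Par !inE ?mem_cat !negb_or /=.
- by case/and4P=> n1 n2 /IH1 -> /IH2 ->; rewrite ![_ == F']eq_sym (negPf n1) (negPf n2).
- by case/and3P=> n1 n2 /IH ->; rewrite !inE (negPf n1) (negPf n2).
Qed.

(** If [F'] is used somewhere in [pi], then [F] lies over that use, hence inside [pi]. *)
Lemma jumpable_edges pi :
  jumpable pi -> F' \in premises (deseq pi) -> F \in edges (deseq pi).
Proof.
elim: pi => [//|pi1 IH1 pi2 IH2 p q r|pi IH p q r];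
  rewrite ?premises_Tens ?premises_Par ?edges_Tens ?edges_Par !inE ?mem_cat /=.
- case/and4P=> /IH1{}IH1 /IH2{}IH2 /implyP hp /implyP hq.
  case/or4P=> [/eqP E|/eqP E|/IH1 ->|/IH2 ->]; rewrite ?orbT //.
  + by rewrite hp ?E ?orbT.
  + by rewrite hq ?E ?orbT.
- case/andP=> /IH{}IH /implyP hp /or3P[/eqP E|/eqP E|/IH ->]; rewrite ?orbT //;
    by rewrite hp ?orbT // !inE E eqxx ?orbT.
Qed.

Lemma rule_ofE sigma pi : rule_of sigma pi ->
  sigma = pi \/ exists2 rho, subproof rho pi & rule_of sigma rho.
Proof. by case=> [|rho tau]; [left | right; exists rho]. Qed.

Lemma deseq_subproof rho pi : subproof rho pi ->
  {subset deseq rho <= deseq pi}.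
Proof.
case: pi => [//|pi1 pi2 p q r|pi1 p q r] /=; last by move=> -> l;
  rewrite inE orbC => ->.
by case=> -> l; rewrite inE mem_cat => ->; rewrite ?orbT.
Qed.

Lemma deseq_rule_of sigma pi : rule_of sigma pi -> {subset deseq sigma <= deseq pi}.
Proof. by elim=> // tau rho _ IH /deseq_subproof sub l /IH /sub. Qed.

Lemma last_link_deseq pi : last_link pi \in deseq pi.
Proof. by case: pi => *; rewrite mem_head. Qed.

Lemma creates_edges sigma pi : rule_of sigma pi -> creates sigma F ->
  F \in edges (deseq pi).
Proof.
move=> /deseq_rule_of sub c; apply/edgesP; exists (last_link sigma) => //.
exact/sub/last_link_deseq.
Qed.

Lemma uses_premises tau pi : rule_of tau pi -> uses tau F' ->
  F' \in premises (deseq pi).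
Proof.
move=> /deseq_rule_of sub c; apply/premisesP; exists (last_link tau) => //.
exact/sub/last_link_deseq.
Qed.

Lemma edges_creates pi : F \in edges (deseq pi) ->
  exists2 sigma, creates sigma F & rule_of sigma pi.
Proof.
elim: pi => [p q A|pi1 IH1 pi2 IH2 p q r|pi IH p q r].
- by exists (Ax p q A) => //; exact: rule_of_last.
- rewrite edges_Tens inE mem_cat => /or3P[c|/IH1|/IH2].
  + by exists (Tens pi1 pi2 p q r); [rewrite /creates inE | exact: rule_of_last].
  + by case=> s cs rs; exists s => //; apply: rule_of_sub rs _; left.
  + by case=> s cs rs; exists s => //; apply: rule_of_sub rs _; right.
- rewrite edges_Par inE => /orP[c|/IH].
  + by exists (Par pi p q r); [rewrite /creates inE | exact: rule_of_last].
  + by case=> s cs rs; exists s => //; apply: rule_of_sub rs _.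
Qed.

(** Edges being distinct, [F'] is used only once, by [tau]. There the clause of [jumpable] holds
    because [F] is an edge of [rho]; at all other rules it is vacuous. *)
Lemma used_jumpable pi Gamma tau rho sigma :
    mll pi Gamma -> uniq (edges (deseq pi)) ->
    rule_of tau pi -> uses tau F' -> subproof rho tau ->
    F' \in conclusions (deseq rho) -> rule_of sigma rho -> creates sigma F ->
  jumpable pi.
Proof.
move=> H U rt ut st; rewrite mem_filter => /andP[nF' eF'] rs cs.
have eF := creates_edges rs cs.
elim: H U rt => { pi Gamma} [p q A
  |pi1 pi2 p q r A B G D H1 IH1 H2 IH2
  |pi p q r A B G H IH|//].
- by move=> _ /rule_ofE[E|[]//]; move: ut; rewrite E.
- rewrite edges_Tens cons_uniq cat_uniq => /and4P[n u1 /hasPn dis u2].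
  have ep := sequent_edges H1 (mem_head _ _);
    have eq := sequent_edges H2 (mem_head _ _).
  have np := sequent_unused H1 u1 (mem_head _ _);
    have nq := sequent_unused H2 u2 (mem_head _ _).
  have p1 := premises_edges H1; have p2 := premises_edges H2.
  case/rule_ofE=> [E|[pi' /= spi' rt]].
    rewrite E /= in ut st; rewrite /uses /= !inE in ut.
    case: st => E'; rewrite E' in nF' eF' eF.
    + rewrite /= eF implybT !jumpable_unused //=; last by apply: contraL eF' => /p2/dis.
      by case: eqP eq => //= -> /dis; rewrite /= eF'.
    + rewrite /= eF implybT !jumpable_unused //= ?andbT;
        last by apply: contraL eF' => /p1 h; apply/negP => /dis /=; rewrite h.
      by case: eqP ep => //= ->; have := dis _ eF' => /= /negPf ->.
  have {ut}uF' := uses_premises rt ut.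
  case: spi' => E; rewrite E in rt uF'.
  + rewrite /= IH1 // jumpable_unused /=; last by apply: contraL (p1 _ uF') => /p2/dis.
    rewrite (_ : p == F' = false); last by apply: contraNF np => /eqP ->.
    by case: eqP eq => //= -> /dis; rewrite /= (p1 _ uF').
  + have n1 : F' \notin edges (deseq pi1) by apply: dis; apply: p2.
    rewrite /= IH2 // jumpable_unused /=; last by apply: contra n1 => /p1.
    rewrite [q == F'](_ : _ = false) ?andbT; last by apply: contraNF nq => /eqP ->.
    by case: eqP ep => //= ->; rewrite (negPf n1).
- rewrite edges_Par cons_uniq => /andP[n u].
  case/rule_ofE=> [E|[pi' /= -> rt]].
    rewrite E /= in ut st; rewrite st in nF' eF' eF.
    by rewrite /= eF implybT jumpable_unused.
  rewrite /= IH //=; case: (boolP (F' \in _)) => //= h.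
  have : F' \in map fst [:: (p, A), (q, B) & G].
    by move: h; rewrite /= !inE => /orP[] ->; rewrite ?orbT.
  by move=> /(sequent_unused H u); rewrite (uses_premises rt ut).
Qed.

(** Going up to the rule that uses [F'], its clause in [jumpable] places [F] over the premise whose
    sequent contains [F']. *)
Lemma jumpable_used pi Gamma :
    mll pi Gamma -> uniq (edges (deseq pi)) -> jumpable pi ->
    F' \in premises (deseq pi) ->
  exists tau rho, [/\ rule_of tau pi, uses tau F', subproof rho tau,
    F' \in conclusions (deseq rho) & F \in edges (deseq rho)].
Proof.
elim=> { pi Gamma} [//|pi1 pi2 p q r A B G D H1 IH1 H2 IH2|pi p q r A B G H IH|//].
- rewrite edges_Tens cons_uniq cat_uniq => /and4P[n u1 _ u2].
  case/and4P=> j1 j2 /implyP jp /implyP jq.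
  rewrite premises_Tens !inE !mem_cat => /or4P[/eqP E|/eqP E|h|h].
  + exists (Tens pi1 pi2 p q r), pi1; split; rewrite ?jp ?E //;
      first exact: rule_of_last.
    * by rewrite /uses /= mem_head.
    * by left.
    * by apply: (sequent_conclusions H1 u1); rewrite mem_head.
  + exists (Tens pi1 pi2 p q r), pi2; split; rewrite ?jq ?E //;
      first exact: rule_of_last.
    * by rewrite /uses /= !inE eqxx orbT.
    * by right.
    * by apply: (sequent_conclusions H2 u2); rewrite mem_head.
  + have [tau [rho [rt ? ? ? ?]]] := IH1 u1 j1 h.
    by exists tau, rho; split=> //; apply: rule_of_sub rt _; left.
  + have [tau [rho [rt ? ? ? ?]]] := IH2 u2 j2 h.
    by exists tau, rho; split=> //; apply: rule_of_sub rt _; right.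
- rewrite edges_Par cons_uniq => /andP[n u] /andP[jpi /implyP jpq].
  rewrite premises_Par -[p :: _]/([:: p; q] ++ _) mem_cat => /orP[|h]; last first.
    have [tau [rho [rt ? ? ? ?]]] := IH u jpi h.
    by exists tau, rho; split=> //; apply: rule_of_sub rt _.
  move=> h; exists (Par pi p q r), pi; split=> //; first exact: rule_of_last.
  + apply: (sequent_conclusions H u); move: h.
    by rewrite /= !inE => /orP[] ->; rewrite ?orbT.
  + exact: jpq.
Qed.

(** When [F'] is used, [jumpable] says that [F] is over that use; when [F'] is a conclusion,
    [jumpable] is vacuous and it only remains that [F] is created in [pi]. *)
Lemma aboveP pi Gamma : mll pi Gamma -> uniq (edges (deseq pi)) ->
    F' \in edges (deseq pi) ->
  above pi F F' <-> F \in edges (deseq pi) /\ jumpable pi.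
Proof.
move=> H U eF'; split.
- case=> sigma cs [[rs]|[tau [rho [rt ut st cF' rs]]]].
    rewrite mem_filter => /andP[/jumpable_unused jpi _].
    by split=> //; apply: creates_edges rs cs.
  split; last exact: used_jumpable H U rt ut st cF' rs cs.
  (* The rule [sigma] over [rho] is followed down through [tau] to the root of [pi]. *)
  by apply: creates_edges cs; elim: rt => { pi H U eF'} [|tau' pi rt IH st'];
    [apply: rule_of_sub rs st | apply: rule_of_sub IH st'].
- case=> eF jpi; have [uF'|nF'] := boolP (F' \in premises (deseq pi)).
    have [tau [rho [rt ut st cF' er]]] := jumpable_used H U jpi uF'.
    have [sigma cs rs] := edges_creates er.
    by exists sigma => //; right; exists tau, rho.
  have [sigma cs rs] := edges_creates eF.
  by exists sigma => //; left; rewrite mem_filter nF' eF'.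
Qed.

End Above.

(** * The jump gadget *)

Section Jump.
Context (X : eqType) (R : graph X) (F F' n : nat).
Hypothesis edges_lt : {in edges R, forall e, e < n}.
Hypothesis premises_edges_R : {subset premises R <= edges R}.
Hypothesis F_lt : F < n.
Hypothesis F'_lt : F' < n.
Implicit Types (rho : proofJ X) (pi : proof X) (S : seq nat).

(* The edges of the gadget: [n] is [J], [n.+1] is [J^\perp], [n.+2] is the       *)
(* conclusion of the tensor and [n.+3] that of the par.                         *)
Definition graft_tens e := if e == F then n.+2 else e.
(** Testing [F'] first matters when [F = F']: the links of [R] then use the conclusion of the par,
    which itself uses that of the tensor. *)
Definition graft e := if e == F' then n.+3 else graft_tens e.
(** The inverse of [graft] on edges of [R]; it will turn out to be what [origin] computes. *)
Definition back e := if e == n.+2 then F else if e == n.+3 then F' else e.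

Definition jlink (l : link X) : link (option X) :=
  match l with
  | LAx p q A => LAx p q (embed A)
  | LTens p q r => LTens (graft p) (graft q) r
  | LPar p q r => LPar (graft p) (graft q) r
  end.

Definition jgraph : graph (option X) :=
  [:: LAx n n.+1 J, LTens F n n.+2, LPar (graft_tens F') n.+1 n.+3 & map jlink R].

(** A partial inverse of [jlink] that discards the gadget: its axiom has a type with no erasure, and
    the conclusions of its tensor and par are not below [n]. *)
Definition unlink (l : link (option X)) : option (link X) :=
  match l with
  | LAx p q A => omap (LAx p q) (erase_formula A)
  | LTens p q r => if r < n then Some (LTens (back p) (back q) r) else None
  | LPar p q r => if r < n then Some (LPar (back p) (back q) r) else None
  end.

Lemma link_lt l : l \in R ->
  {in link_concl l, forall e, e < n} * {in link_prem l, forall e, e < n}.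
Proof.
move=> lR; split=> e el; apply: edges_lt.
- by apply/edgesP; exists l.
- by apply: premises_edges_R; apply/premisesP; exists l.
Qed.

Lemma LAx_lt p q A : LAx p q A \in R -> (p < n) && (q < n).
Proof.
by case/link_lt=> H _; apply/andP; split; apply: H; rewrite !inE eqxx ?orbT.
Qed.

Lemma LTens_lt p q r : LTens p q r \in R -> [&& p < n, q < n & r < n].
Proof.
case/link_lt=> H H'; apply/and3P.
by split; [apply: H'|apply: H'|apply: H]; rewrite !inE eqxx ?orbT.
Qed.

Lemma LPar_lt p q r : LPar p q r \in R -> [&& p < n, q < n & r < n].
Proof.
case/link_lt=> H H'; apply/and3P.
by split; [apply: H'|apply: H'|apply: H]; rewrite !inE eqxx ?orbT.
Qed.

Lemma graft_tens_neq e : e < n -> (graft_tens e != n) && (graft_tens e != n.+1).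
Proof. by rewrite /graft_tens; case: ifP; lia. Qed.

Lemma graft_neq e : e < n -> (graft e != n) && (graft e != n.+1).
Proof. by rewrite /graft /graft_tens; repeat case: ifP; lia. Qed.

Lemma back_graft e : e < n -> back (graft e) = e.
Proof.
rewrite /back /graft /graft_tens => en.
by have [->|_] := eqVneq e F'; [|have [->|_] := eqVneq e F]; repeat case: ifP; lia.
Qed.

Lemma back_graft_tens : back (graft_tens F') = F'.
Proof. by rewrite /back /graft_tens; repeat case: ifP; lia. Qed.

Lemma back_id e : e < n.+2 -> back e = e.
Proof. by rewrite /back; repeat case: ifP; lia. Qed.

Lemma unlink_jlink l : l \in R -> unlink (jlink l) = Some l.
Proof.
case: l => [p q A|p q r|p q r] /=; first by rewrite erase_embed.
- by move=> /LTens_lt/and3P[hp hq ->]; rewrite !back_graft.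
- by move=> /LPar_lt/and3P[hp hq ->]; rewrite !back_graft.
Qed.


Lemma jgraphP l : l \in jgraph ->
  [\/ l = LAx n n.+1 J, l = LTens F n n.+2, l = LPar (graft_tens F') n.+1 n.+3 |
      exists2 l0, l0 \in R & l = jlink l0].
Proof.
rewrite !inE => /or4P[/eqP ->|/eqP ->|/eqP ->|/mapP]; by constructor.
Qed.

(** * Sequentializations of the jump as untyped proofs *)

(* The proofs of MLL_J with links in [jgraph], without types: a conclusion of   *)
(* such a proof has type [J] or [J^\perp] if and only if it is [n.+1].           *)
Inductive jproof : proofJ X -> seq nat -> Prop :=
| jproof_ax p q A : LAx p q A \in R -> jproof (JAx p q A) [:: p; q]
| jproof_mtens rho1 rho2 p q r S1 S2 :
    LTens p q r \in R -> jproof rho1 (graft p :: S1) -> jproof rho2 (graft q :: S2) ->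
    jproof (JMTens rho1 rho2 (graft p) (graft q) r) (r :: S1 ++ S2)
| jproof_mpar rho p q r S :
    LPar p q r \in R -> jproof rho [:: graft p, graft q & S] ->
    jproof (JMPar rho (graft p) (graft q) r) (r :: S)
| jproof_jtens rho S :
    jproof rho (F :: S) ->
    jproof (JTens rho F n n.+1 n.+2) [:: n.+2, n.+1 & S]
| jproof_jpar rho S :
    jproof rho [:: graft_tens F', n.+1 & S] ->
    jproof (JPar rho (graft_tens F') n.+1 n.+3) (n.+3 :: S)
| jproof_exchange rho S S' : perm_eq S S' -> jproof rho S -> jproof rho S'.

(** Each rule is matched with the only kind of link it can come from. The invariant on types
    excludes the mismatches: [n] never reaches a sequent, since the special tensor rule consumes it
    at once, and [n.+1] is the only occurrence of an atom [J] or its dual. *)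
Lemma mllJ_jproof rho Gamma : mllJ rho Gamma ->
  {subset deseqJ rho <= jgraph} ->
  jproof rho (map fst Gamma) /\
  {in Gamma, forall x, (x.1 != n) && (is_J x.2 == (x.1 == n.+1))}.
Proof.
elim=> { rho Gamma} [p q A
  |rho1 rho2 p q r A B G D nA nB _ IH1 _ IH2
  |rho p q r A B G nA nB _ IH
  |rho p j j' r A G nA _ IH
  |rho p j' r A G nA _ IH
  |rho G D GD _ IH] sub_R.
- case: (jgraphP (sub_R _ (mem_head _ _))) => // [[_ _]|[[p' q' A'|//|//] lR [-> -> ]]].
    by move=> /(congr1 (@erase_formula X)); rewrite erase_embed.
  move=> /embed_inj ->; have /andP[hp hq] := LAx_lt lR; split; first exact: jproof_ax.
  have nJ (C : formula X) : is_J (embed C) = false by case: C.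
  by move=> x; rewrite !inE dual_embed => /orP[] /eqP -> /=; rewrite nJ; lia.
- have [|H1 T1] := IH1; first by move=> l h; apply: sub_R;
    rewrite /= inE mem_cat h orbT.
  have [|H2 T2] := IH2; first by move=> l h; apply: sub_R;
    rewrite /= inE mem_cat h !orbT.
  (* The tensor of the gadget cannot end with an ordinary tensor rule, as [n] would have to be in
     the second sequent. *)
  have /andP[/= + _] := T2 _ (mem_head _ _) => nq.
  case: (jgraphP (sub_R _ (mem_head _ _))) => // [[_ E _]|[[//|p' q' r'|//] lR [Ep Eq Er]]].
    by rewrite E eqxx in nq.
  rewrite Ep Eq Er /= in H1 H2 T1 T2 *.
  have /and3P[_ _ hr] := LTens_lt lR.
  split; first by rewrite map_cat; exact: jproof_mtens.
  move=> x; rewrite inE mem_cat => /or3P[/eqP ->|h|h] /=; first by lia.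
  + by apply: T1; rewrite inE h orbT.
  + by apply: T2; rewrite inE h orbT.
- have [|H T] := IH; first by move=> l h; apply: sub_R; rewrite /= inE h orbT.
  (* As [B] is not a special atom, [q] differs from [n.+1], which excludes the par of the gadget. *)
  have /andP[/= _] := T (q, B) ltac:(by rewrite !inE eqxx orbT).
  rewrite (negPf nB) /= => /eqP nq.
  case: (jgraphP (sub_R _ (mem_head _ _))) => // [[_ E _]|[[//|//|p' q' r'] lR [Ep Eq Er]]].
    by rewrite E eqxx in nq.
  rewrite Ep Eq Er /= in H T *.
  have /and3P[_ _ hr] := LPar_lt lR.
  split; first exact: jproof_mpar.
  move=> x; rewrite inE => /orP[/eqP ->|h] /=; first by lia.
  by apply: T; rewrite !inE h !orbT.
- have [|H T] := IH; first by move=> l h; apply: sub_R; rewrite /= !inE h !orbT.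
  (* An axiom on [J] is not the embedding of an axiom of [R], so it is that of the gadget; its edge
     [n] then singles out the tensor of the gadget. *)
  have := jgraphP (sub_R (LAx j j' J) ltac:(by rewrite /= !inE eqxx orbT)).
  case=> // [[Ej Ej']|[[p' q' A'|//|//] _ [_ _]]]; last first.
    by move=> /(congr1 (@erase_formula X)); rewrite erase_embed.
  rewrite {}Ej {}Ej' in sub_R *.
  case: (jgraphP (sub_R _ (mem_head _ _))) => // [[Ep Er]|[[//|p' q' r'|//] lR [_ Eq _]]]; last first.
    by have /and3P[_ /graft_neq + _] := LTens_lt lR; rewrite -Eq eqxx.
  rewrite {}Ep {}Er /= in H T *; split; first exact: jproof_jtens.
  move=> x; rewrite !inE => /or3P[/eqP ->|/eqP ->|h] /=; [by lia|by rewrite eqxx; lia|].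
  by apply: T; rewrite inE h orbT.
- have [|H T] := IH; first by move=> l h; apply: sub_R; rewrite /= inE h orbT.
  have /andP[/= _] := T (j', Jd) ltac:(by rewrite !inE eqxx orbT).
  rewrite eq_sym eqb_id => /eqP Ej; rewrite {}Ej in sub_R H T *.
  case: (jgraphP (sub_R _ (mem_head _ _))) => // [[Ep Er]|[[//|//|p' q' r'] lR [_ Eq _]]]; last first.
    by have /and3P[_ /graft_neq + _] := LPar_lt lR; rewrite -Eq eqxx andbF.
  rewrite {}Ep {}Er /= in H T *; split; first exact: jproof_jpar.
  move=> x; rewrite !inE => /orP[/eqP ->|h] /=; first by lia.
  by apply: T; rewrite !inE h !orbT.
- have [H T] := IH sub_R; split; first by apply: jproof_exchange H; apply: perm_map.
  by move=> x; rewrite -(perm_mem GD); apply: T.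
Qed.

(** Types are rebuilt from the axioms downward. Side conditions only concern the special atoms, and
    these are located by the name [n.+1]. *)
Lemma jproofP rho S : jproof rho S ->
  exists Gamma, [/\ mllJ rho Gamma, map fst Gamma = S &
    {in Gamma, forall x, if x.1 == n.+1 then x.2 == Jd else ~~ is_J x.2}].
Proof.
elim=> { rho S} [p q A lR
  |rho1 rho2 p q r S1 S2 lR _ [[|[p0 A] G] [//= H1 [Ep <-] T1]]
     _ [[|[q0 B] D] [//= H2 [Eq <-] T2]]
  |rho p q r S lR _ [[|[p0 A] [|[q0 B] G]] [//= H [Ep Eq <-] T]]
  |rho S _ [[|[p0 A] G] [//= H [Ep <-] T]]
  |rho S _ [[|[p0 A] [|[q0 B] G]] [//= H [Ep Eq <-] T]]
  |rho S S' SS' _ [G [H GS T]]].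
- exists [:: (p, embed A); (q, dual (embed A))]; split=> //; first exact: mllJ_ax.
  have /andP[hp hq] := LAx_lt lR.
  have nJ (C : formula X) : is_J (embed C) = false by case: C.
  by move=> x; rewrite !inE dual_embed => /orP[] /eqP -> /=; rewrite nJ; case: ifP; lia.
- rewrite {}Ep {}Eq in H1 T1 H2 T2.
  have /and3P[/graft_neq/andP[_ /negPf hp] /graft_neq/andP[_ /negPf hq] hr] := LTens_lt lR.
  have := T1 _ (mem_head _ _); have := T2 _ (mem_head _ _); rewrite /= hp hq => nB nA.
  exists ((r, FTens A B) :: G ++ D); split;
    [exact: mllJ_mtens | by rewrite /= map_cat |].
  move=> x; rewrite inE mem_cat => /or3P[/eqP -> /=|h|h]; first by case: ifP => //; lia.
  + by apply: T1; rewrite inE h orbT.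
  + by apply: T2; rewrite inE h orbT.
- rewrite {}Ep {}Eq in H T.
  have /and3P[/graft_neq/andP[_ /negPf hp] /graft_neq/andP[_ /negPf hq] hr] := LPar_lt lR.
  have := T _ (mem_head _ _); have := T (graft q, B);
    rewrite /= hp hq !inE eqxx orbT => /(_ isT) nB nA.
  exists ((r, FPar A B) :: G); split=> //; first exact: mllJ_mpar.
  move=> x; rewrite inE => /orP[/eqP -> /=|h]; first by case: ifP => //; lia.
  by apply: T; rewrite !inE h !orbT.
- rewrite {}Ep in H T.
  have := T _ (mem_head _ _); rewrite /= ifF => [nA|]; last by lia.
  exists [:: (n.+2, FTens A J), (n.+1, Jd) & G]; split=> //; first exact: mllJ_jtens.
  move=> x; rewrite !inE => /or3P[/eqP -> /=|/eqP -> /=|h];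
    last by apply: T; rewrite inE h orbT.
  + by case: ifP => //; lia.
  + by rewrite !eqxx.
- rewrite {}Ep {}Eq in H T.
  have /andP[_ /negPf hF'] := graft_tens_neq F'_lt.
  have := T _ (mem_head _ _); have := T (n.+1, B).
  rewrite /= hF' !inE !eqxx orbT => /(_ isT) /eqP EB nA; rewrite {}EB in H T.
  exists ((n.+3, FPar A Jd) :: G); split=> //; first exact: mllJ_jpar.
  move=> x; rewrite inE => /orP[/eqP -> /=|h]; first by case: ifP => //; lia.
  by apply: T; rewrite !inE h !orbT.
- rewrite -GS perm_sym in SS'; have [D DG DS'] := perm_map_lift SS'.
  exists D; split=> //; first by apply: mllJ_exchange H; rewrite perm_sym.
  by move=> x; rewrite (perm_mem DG); apply: T.
Qed.

Lemma jproof_edges rho S : jproof rho S -> {subset S <= edges (deseqJ rho)}.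
Proof. by case/jproofP=> G [H <- _]; apply: mllJ_edges H. Qed.

(** * Effect of erasure on edges and links *)

Lemma edges_JMTens rho1 rho2 p q r :
  edges (deseqJ (JMTens rho1 rho2 p q r)) =
  r :: edges (deseqJ rho1) ++ edges (deseqJ rho2).
Proof. by rewrite -edges_cat. Qed.

Lemma edges_JMPar rho p q r :
  edges (deseqJ (JMPar rho p q r)) = r :: edges (deseqJ rho).
Proof. by []. Qed.

Lemma edges_JTens rho p j j' r :
  edges (deseqJ (JTens rho p j j' r)) = [:: r, j, j' & edges (deseqJ rho)].
Proof. by []. Qed.

Lemma edges_JPar rho p j' r :
  edges (deseqJ (JPar rho p j' r)) = r :: edges (deseqJ rho).
Proof. by []. Qed.

Definition edgesJE := (edges_JMTens, edges_JMPar, edges_JTens, edges_JPar).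

(** A jump rule redirects only its own conclusion, and distinctness of names keeps the redirections
    made in different subproofs from interfering. *)
Lemma jproof_origin rho S : jproof rho S -> uniq (edges (deseqJ rho)) ->
  {in edges (deseqJ rho), origin rho =1 back}.
Proof.
elim=> { rho S} [p q A lR
  |rho1 rho2 p q r S1 S2 lR H1 IH1 H2 IH2
  |rho p q r S lR H IH
  |rho S H IH
  |rho S H IH|//];
  rewrite ?edgesJE => + e.
- have /andP[hp hq] := LAx_lt lR.
  by move=> _; rewrite !inE => /orP[] /eqP -> /=; rewrite back_id //; lia.
- have /and3P[_ _ hr] := LTens_lt lR; have br : back r = r by apply: back_id; lia.
  rewrite cons_uniq mem_cat negb_or cat_uniq => /and4P[/andP[r1 r2] u1 /hasPn dis u2].
  rewrite inE mem_cat /= => /or3P[/eqP ->|e1|e2].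
  + by rewrite (origin_out r2) (origin_out r1).
  + by rewrite (@origin_out _ rho2) ?IH1 //; apply/negP => /dis; rewrite /= e1.
  (* The origin of [e] in [rho2] is again an edge of [rho2], hence not of [rho1], which leaves it
     unchanged. *)
  + have [G [m2 _ _]] := jproofP H2.
    by rewrite (@origin_out _ rho1) ?IH2 // -IH2 //; apply: dis;
      apply: origin_in m2 _ _.
- have /and3P[_ _ hr] := LPar_lt lR; have br : back r = r by apply: back_id; lia.
  rewrite cons_uniq => /andP[hr' u]; rewrite inE /= => /orP[/eqP ->|he]; last exact: IH.
  by rewrite origin_out.
- rewrite !cons_uniq !inE !negb_or => /and4P[/and3P[_ _ n2] /andP[_ n0] n1 u].
  have FS := jproof_edges H (mem_head _ _).
  case/or4P=> [/eqP ->|/eqP ->|/eqP ->|he] /=.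
  + by rewrite eqxx IH // back_id /back ?eqxx //; lia.
  + by rewrite ifF ?origin_out ?back_id //; lia.
  + by rewrite ifF ?origin_out ?back_id //; lia.
  + by case: eqP n2 => [<-|_ _]; [rewrite he | apply: IH].
- rewrite cons_uniq => /andP[n3 u]; have F'S := jproof_edges H (mem_head _ _).
  rewrite inE /= => /orP[/eqP ->|he].
    (* If [F = F'], two redirections are chained: [n.+3] becomes [n.+2], then [F]. *)
    by rewrite eqxx IH // back_graft_tens /back eqxx ifF //; lia.
  by case: eqP n3 => [<-|_ _]; [rewrite he | apply: IH].
Qed.

Lemma jproof_deseq rho S : jproof rho S -> uniq (edges (deseqJ rho)) ->
  deseq (erase rho) = pmap unlink (deseqJ rho).
Proof.
elim=> { rho S} [p q A lR
  |rho1 rho2 p q r S1 S2 lR H1 IH1 H2 IH2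
  |rho p q r S lR H IH
  |rho S H IH
  |rho S H IH|//];
  rewrite ?edgesJE.
- by rewrite /= erase_embed.
- rewrite cons_uniq cat_uniq => /and4P[_ u1 _ u2] /=.
  have /and3P[_ _ ->] := LTens_lt lR; rewrite pmap_cat -IH1 // -IH2 //=.
  by rewrite (jproof_origin H1) ?(jproof_origin H2) //;
    [apply: jproof_edges H2 _ _ | apply: jproof_edges H1 _ _]; rewrite mem_head.
- rewrite cons_uniq => /andP[_ u] /=.
  have /and3P[_ _ ->] := LPar_lt lR; rewrite -IH //=.
  by rewrite !(jproof_origin H) //; apply: jproof_edges H _ _; rewrite !inE eqxx ?orbT.
- by rewrite !cons_uniq => /and4P[_ _ _ u] /=; rewrite ifF ?IH //; lia.
- by rewrite cons_uniq => /andP[_ u] /=; rewrite ifF ?IH //; lia.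
Qed.

(** * Erased proofs have [F] above [F'] *)

Lemma jproof_erase_edges rho S e : jproof rho S -> e < n ->
  e \in edges (deseqJ rho) -> e \in edges (deseq (erase rho)).
Proof.
move=> H en.
elim: H => { rho S} [//
  |rho1 rho2 p q r S1 S2 lR H1 IH1 H2 IH2
  |rho p q r S lR H IH
  |rho S H IH
  |rho S H IH|//];
  rewrite ?edgesJE /erase -/erase ?edges_Tens ?edges_Par !inE ?mem_cat.
- by case/or3P=> [->//|/IH1 ->|/IH2 ->]; rewrite ?orbT.
- by case/orP=> [->//|/IH ->]; rewrite ?orbT.
- by case/or4P=> //; lia.
- by case/orP=> //; lia.
Qed.

(** Only the tensor rule of the gadget creates [n.+1], and its premise contains [F]. *)
Lemma jproof_tens_above rho S : jproof rho S ->
  n.+1 \in edges (deseqJ rho) -> F \in edges (deseq (erase rho)).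
Proof.
elim=> { rho S} [p q A lR
  |rho1 rho2 p q r S1 S2 lR H1 IH1 H2 IH2
  |rho p q r S lR H IH
  |rho S H IH
  |rho S H IH|//];
  rewrite ?edgesJE /erase -/erase ?edges_Tens ?edges_Par !inE ?mem_cat.
- by have := LAx_lt lR; lia.
- have := LTens_lt lR => hr; case/or3P=> [|/IH1 ->|/IH2 ->]; rewrite ?orbT //; lia.
- have := LPar_lt lR => hr; case/orP=> [|/IH ->]; rewrite ?orbT //; lia.
- by move=> _; apply: (jproof_erase_edges H) => //; apply: (jproof_edges H);
    rewrite mem_head.
- by case/orP=> //; lia.
Qed.

Lemma jproof_par_above rho S : jproof rho S ->
  n.+3 \in edges (deseqJ rho) -> n.+1 \in edges (deseqJ rho).
Proof.
elim=> { rho S} [p q A lR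
  |rho1 rho2 p q r S1 S2 lR H1 IH1 H2 IH2
  |rho p q r S lR H IH
  |rho S H IH
  |rho S H IH|//];
  rewrite ?edgesJE !inE ?mem_cat.
- by have := LAx_lt lR; lia.
- have := LTens_lt lR => hr; case/or3P=> [|/IH1 ->|/IH2 ->]; rewrite ?orbT //; lia.
- have := LPar_lt lR => hr; case/orP=> [|/IH ->]; rewrite ?orbT //; lia.
- by rewrite eqxx !orbT.
- by move=> _; rewrite (jproof_edges H) ?orbT // !inE eqxx orbT.
Qed.

(** The origin of [graft p] is [p], so [p = F'] and [graft p] is [n.+3]. Over it lies the par of the
    gadget, which needs [n.+1], hence the tensor and [F]. *)
Lemma jproof_used rho S p : jproof rho S -> uniq (edges (deseqJ rho)) ->
    p < n -> graft p \in S -> origin rho (graft p) = F' ->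
  F \in edges (deseq (erase rho)).
Proof.
move=> H u hp pS; rewrite (jproof_origin H) ?(jproof_edges H) // back_graft // => E.
apply: (jproof_tens_above H); apply: (jproof_par_above H); apply: (jproof_edges H).
by move: pS; rewrite E /graft eqxx.
Qed.

Lemma jproof_jumpable rho S : jproof rho S -> uniq (edges (deseqJ rho)) ->
  jumpable F F' (erase rho).
Proof.
elim=> { rho S} [p q A lR
  |rho1 rho2 p q r S1 S2 lR H1 IH1 H2 IH2
  |rho p q r S lR H IH
  |rho S H IH
  |rho S H IH|//];
  rewrite ?edgesJE //.
- rewrite cons_uniq cat_uniq => /and4P[_ u1 _ u2] /=;
    have /and3P[hp hq _] := LTens_lt lR.
  rewrite IH1 // IH2 //=; apply/andP; split; apply/implyP => /eqP.
  + by apply: jproof_used H1 u1 hp _; rewrite mem_head.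
  + by apply: jproof_used H2 u2 hq _; rewrite mem_head.
- rewrite cons_uniq => /andP[_ u] /=; have /and3P[hp hq _] := LPar_lt lR.
  rewrite IH //=; apply/implyP; rewrite !inE => /orP[] /eqP/esym.
  + by apply: jproof_used H u hp _; rewrite mem_head.
  + by apply: jproof_used H u hq _; rewrite !inE eqxx orbT.
- by rewrite !cons_uniq => /and4P[_ _ _ u] /=; apply: IH.
- by rewrite cons_uniq => /andP[_ u] /=; apply: IH.
Qed.

(** * Insertion of the gadget into a proof *)

Lemma graft_tensF : graft_tens F = n.+2.
Proof. by rewrite /graft_tens eqxx. Qed.

Lemma graftF' : graft F' = n.+3.
Proof. by rewrite /graft eqxx. Qed.

(** Here [c] lists the edges just created by the last rule of [rho]; an axiom creates two. *)
Definition wrap_tens (c : seq nat) rho :=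
  if F \in c then JTens rho F n n.+1 n.+2 else rho.

(** Here [c] lists the edges about to be used by the rule below, or the whole sequent at the
    root. *)
Definition wrap_par (c : seq nat) rho :=
  if F' \in c then JPar rho (graft_tens F') n.+1 n.+3 else rho.

(* Tensor right below the creation of [F], par right above the use of [F'];    *)
(* a conclusion [F'] is left to an outer [wrap_par].                           *)
Fixpoint insert pi : proofJ X :=
  match pi with
  | Ax p q A => wrap_tens [:: p; q] (JAx p q A)
  | Tens pi1 pi2 p q r =>
      wrap_tens [:: r] (JMTens (wrap_par [:: p] (insert pi1))
                               (wrap_par [:: q] (insert pi2)) (graft p) (graft q) r)
  | Par pi1 p q r =>
      wrap_tens [:: r] (JMPar (wrap_par [:: p; q] (insert pi1)) (graft p) (graft q) r)
  end.

(* Whether [J^\perp] is among the conclusions of [insert pi]. *)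
Definition pending pi :=
  (F \in edges (deseq pi)) && (F' \notin premises (deseq pi)).

(** The occurrence [n.+1] is carried with a boolean multiplicity: the tensor adds it exactly when
    [F] is in [c]. *)
Lemma wrap_tens_jproof c rho S : uniq c -> jproof rho (c ++ S) ->
  jproof (wrap_tens c rho) (map graft_tens c ++ S ++ nseq (F \in c) n.+1).
Proof.
rewrite /wrap_tens => uc H; case: ifP => cF; last first.
  rewrite cats0 (_ : map graft_tens c = c) //.
  rewrite -[RHS]map_id; apply/eq_in_map => e ec.
  by rewrite /graft_tens; case: eqP => // eF; rewrite -eF ec in cF.
have pc := perm_to_rem cF.
have {}H : jproof rho (F :: rem F c ++ S).
  by apply: jproof_exchange H; rewrite -cat_cons perm_cat2r.
apply: jproof_exchange (jproof_jtens H).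
have -> : rem F c = map graft_tens (rem F c).
  rewrite -[LHS]map_id; apply/eq_in_map => e.
  by rewrite mem_rem_uniq // inE /graft_tens => /andP[/negPf -> _].
have /permP := perm_map graft_tens pc => pc'; apply/permP => a; move: (pc' a).
by rewrite /= !count_cat /= graft_tensF; lia.
Qed.

(** The boolean [b] tells whether [n.+1] is available; the par, inserted when [F'] is in [c],
    consumes it. *)
Lemma wrap_par_jproof c rho S (b : bool) : uniq c -> (F' \in c -> b) ->
  jproof rho (map graft_tens (c ++ S) ++ nseq b n.+1) ->
  jproof (wrap_par c rho) (map graft c ++ map graft_tens S ++ nseq (b &&
    (F' \notin c)) n.+1).
Proof.
rewrite /wrap_par => uc cb H; case: ifP cb => cF' cb; last first.
  rewrite andbT catA (_ : map graft c = map graft_tens c) -?map_cat //.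
  apply/eq_in_map => e ec.
  by rewrite /graft; case: eqP => // eF; rewrite -eF ec in cF'.
have pc := perm_to_rem cF'; rewrite {b}cb // in H *.
have {}H : jproof rho [:: graft_tens F', n.+1 & map graft_tens (rem F' c ++ S)].
  apply: jproof_exchange H; have /permP := perm_map graft_tens pc => pc'.
  by apply/permP => a; move: (pc' a); rewrite !map_cat /= !count_cat /=; lia.
apply: jproof_exchange (jproof_jpar H).
have /permP := perm_map graft pc => pc'; apply/permP => a; move: (pc' a).
rewrite map_cat /= !count_cat /= graftF' => ->; rewrite addn0 addnA.
congr (_ + count a _ + _); apply/eq_in_map => e.
by rewrite mem_rem_uniq // inE /graft => /andP[/negPf -> _].
Qed.

Lemma wrap_par_insert pi Gamma c S : mll pi Gamma -> uniq (edges (deseq pi)) ->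
    map fst Gamma = c ++ S -> (F' \in c -> F \in edges (deseq pi)) ->
    jproof (insert pi) (map graft_tens (map fst Gamma) ++ nseq (pending pi) n.+1) ->
  jproof (wrap_par c (insert pi))
    (map graft c ++ map graft_tens S ++ nseq (pending pi && (F' \notin c)) n.+1).
Proof.
move=> H U E cF; rewrite E => Hi; apply: wrap_par_jproof => //.
  by move: U; rewrite (perm_uniq (mll_edges H)) E !cat_uniq => /and3P[_ _ /andP[]].
move=> cF'; rewrite /pending cF //= (sequent_unused H U) //.
by rewrite E mem_cat cF'.
Qed.

(** The sequent of [pi] changes in two ways only: [F] becomes the conclusion of the tensor, and
    [n.+1] is present between the tensor and the par. [F'] keeps its place, since its par is
    inserted only when a rule uses it. *)
Lemma insert_jproof pi Gamma : mll pi Gamma -> {subset deseq pi <= R} ->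
    uniq (edges (deseq pi)) -> jumpable F F' pi ->
  jproof (insert pi) (map graft_tens (map fst Gamma) ++ nseq (pending pi) n.+1).
Proof.
elim=> { pi Gamma} [p q A
  |pi1 pi2 p q r A B G D H1 IH1 H2 IH2
  |pi p q r A B G H IH
  |pi G D GD H IH] sR.
- move=> u _; rewrite /pending andbT.
  have := @wrap_tens_jproof [:: p; q] (JAx p q A) [::] u.
  by apply; apply: jproof_ax; apply: sR; rewrite mem_head.
- rewrite edges_Tens cons_uniq cat_uniq => /and4P[n0 u1 /hasPn dis u2].
  case/and4P=> j1 j2 /implyP jp /implyP jq.
  have {}IH1 := IH1 (fun l h => sR l ltac:(by rewrite /= inE mem_cat h orbT)) u1 j1.
  have {}IH2 := IH2 (fun l h => sR l ltac:(by rewrite /= inE mem_cat h !orbT)) u2 j2.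
  have K1 := @wrap_par_insert _ _ [:: p] (map fst G) H1 u1 erefl.
  have K2 := @wrap_par_insert _ _ [:: q] (map fst D) H2 u2 erefl.
  have {}K1 := K1 ltac:(by rewrite inE eq_sym) IH1.
  have {}K2 := K2 ltac:(by rewrite inE eq_sym) IH2.
  have lR : LTens p q r \in R by apply: sR; rewrite mem_head.
  have := @wrap_tens_jproof [:: r] _ _ isT (jproof_mtens lR K1 K2).
  apply: jproof_exchange; apply/permP => a.
  (* A pending [n.+1] has a single source: the tensor inserted here, or one premise that did not
     consume it. This relies on [F] being created only once and on [jumpable], which prevents [F']
     from being used away from [F]. *)
  have -> : pending (Tens pi1 pi2 p q r) = (F \in [:: r]) +
      (pending pi1 && (F' \notin [:: p])) + (pending pi2 && (F' \notin [:: q])) :> nat.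
    have n1 : F == r -> F \notin edges (deseq pi1) ++ edges (deseq pi2)
      by move/eqP=> ->.
    move: (introT implyP (jumpable_edges j1)) (introT implyP (jumpable_edges j2)).
    move: (introT implyP jp) (introT implyP jq) (introT implyP n1) (introT implyP
      (dis F)).
    rewrite /pending edges_Tens premises_Tens !inE !mem_cat /= ![_ == F']eq_sym.
    by do ![case: (_ \in _)|case: (_ == _)].
  move: (nat_of_bool (F \in [:: r])) (nat_of_bool (pending pi1 && _))
    (nat_of_bool (pending pi2 && _)) => b0 b1 b2.
  rewrite /= !(map_cat, count_cat, count_nseq).
  by clear; case: (a n.+1) => /=; lia.
- rewrite edges_Par cons_uniq => /andP[n0 u] /andP[jpi /implyP jpq].
  have {}IH := IH (fun l h => sR l ltac:(by rewrite /= inE h orbT)) u jpi.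
  have K := @wrap_par_insert _ _ [:: p; q] (map fst G) H u erefl jpq IH.
  have lR : LPar p q r \in R by apply: sR; rewrite mem_head.
  have := @wrap_tens_jproof [:: r] _ _ isT (jproof_mpar lR K).
  apply: jproof_exchange; apply/permP => a.
  have -> : pending (Par pi p q r) = (F \in [:: r]) +
      (pending pi && (F' \notin [:: p; q])) :> nat.
    have n1 : F == r -> F \notin edges (deseq pi) by move/eqP=> ->.
    move: (introT implyP (jumpable_edges jpi)) (introT implyP jpq) (introT implyP n1).
    rewrite /pending edges_Par premises_Par !inE.
    by do ![case: (_ \in _)|case: (_ == _)].
  move: (nat_of_bool (F \in [:: r])) (nat_of_bool (pending pi && _)) => b0 b1.
  rewrite /= !(count_cat, count_nseq).
  by clear; case: (a n.+1) => /=; lia.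
- move=> u j; apply: jproof_exchange (IH sR u j).
  by rewrite perm_cat2r !perm_map.
Qed.

(** * Links and erasure of the inserted proof *)

Lemma count_wrap_tens a c rho : count a (deseqJ (wrap_tens c rho)) =
  (F \in c) * (a (LTens F n n.+2) + a (LAx n n.+1 J)) + count a (deseqJ rho).
Proof. by rewrite /wrap_tens; case: ifP => //= _; lia. Qed.

Lemma count_wrap_par a c rho : count a (deseqJ (wrap_par c rho)) =
  (F' \in c) * a (LPar (graft_tens F') n.+1 n.+3) + count a (deseqJ rho).
Proof. by rewrite /wrap_par; case: ifP => //= _; lia. Qed.

Local Ltac generalize_bools := clear;
  repeat match goal with |- context [nat_of_bool ?b] => move: (nat_of_bool b) => ? end.

(** Counting with an arbitrary predicate [a] amounts to comparing links up to permutation. The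
    tensor and its axiom appear once [F] is created, the par once [F'] is used. *)
Lemma count_insert a pi : uniq (edges (deseq pi)) -> uniq (premises (deseq pi)) ->
  count a (deseqJ (insert pi)) = count a (map jlink (deseq pi)) +
    (F \in edges (deseq pi)) * (a (LTens F n n.+2) + a (LAx n n.+1 J)) +
    (F' \in premises (deseq pi)) * a (LPar (graft_tens F') n.+1 n.+3).
Proof.
have wt := count_wrap_tens a; have wp := count_wrap_par a; move: wt wp.
move: (a (LTens _ _ _) + _) (nat_of_bool (a (LPar _ _ _))) => kt kp wt wp.
elim: pi => [p q A|pi1 IH1 pi2 IH2 p q r|pi IH p q r].
- by rewrite /= wt /edges /premises /= mul0n !addn0 addnC.
- rewrite edges_Tens premises_Tens -cat1s.
  rewrite -[[:: p, q & _]]/([:: p] ++ [:: q] ++ _) => uE uP.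
  have := uE; rewrite cat_uniq => /and3P[_ _ uE']; have := uE'.
  rewrite cat_uniq => /and3P[uE1 _ uE2].
  have := uP; rewrite cat_uniq => /and3P[_ _ uP']; have := uP'.
  rewrite cat_uniq => /and3P[_ _ uP'']; have := uP''.
  rewrite cat_uniq => /and3P[uP1 _ uP2].
  rewrite !mem_cat_disjoint //= wt /= !count_cat !wp IH1 // IH2 // map_cat count_cat.
  by rewrite !mulnDl; generalize_bools; lia.
- rewrite edges_Par premises_Par -cat1s.
  rewrite -[[:: p, q & _]]/([:: p; q] ++ _) => uE uP.
  have := uE; rewrite cat_uniq => /and3P[_ _ uE'].
  have := uP; rewrite cat_uniq => /and3P[_ _ uP'].
  rewrite !mem_cat_disjoint //= wt /= wp IH //.
  by rewrite !mulnDl; generalize_bools; lia.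
Qed.

Lemma erase_wrap_tens c rho : erase (wrap_tens c rho) = erase rho.
Proof. by rewrite /wrap_tens; case: ifP. Qed.

Lemma erase_wrap_par c rho : erase (wrap_par c rho) = erase rho.
Proof. by rewrite /wrap_par; case: ifP. Qed.

Lemma uniq_wrap_tens c rho :
  uniq (edges (deseqJ (wrap_tens c rho))) -> uniq (edges (deseqJ rho)).
Proof. by rewrite /wrap_tens; case: ifP => // _;
  rewrite edgesJE !cons_uniq => /and4P[]. Qed.

Lemma uniq_wrap_par c rho :
  uniq (edges (deseqJ (wrap_par c rho))) -> uniq (edges (deseqJ rho)).
Proof. by rewrite /wrap_par; case: ifP => // _;
  rewrite edgesJE cons_uniq => /andP[]. Qed.

(** The inserted rules disappear, and the premises renamed by [graft] recover their names because
    [origin] acts as [back]. *)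
Lemma erase_insert pi Gamma : mll pi Gamma -> {subset deseq pi <= R} ->
    uniq (edges (deseq pi)) -> jumpable F F' pi ->
    uniq (edges (deseqJ (insert pi))) ->
  erase (insert pi) = pi.
Proof.
elim=> { pi Gamma} [p q A
  |pi1 pi2 p q r A B G D H1 IH1 H2 IH2
  |pi p q r A B G H IH|//] sR.
- by rewrite erase_wrap_tens.
- rewrite edges_Tens cons_uniq cat_uniq => /and4P[_ u1 _ u2].
  case/and4P=> j1 j2 /implyP jp /implyP jq /uniq_wrap_tens.
  rewrite edgesJE cons_uniq cat_uniq => /and4P[_ v1 _ v2].
  have sR1 : {subset deseq pi1 <= R} by move=> l h; apply: sR;
    rewrite /= inE mem_cat h orbT.
  have sR2 : {subset deseq pi2 <= R} by move=> l h; apply: sR;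
    rewrite /= inE mem_cat h !orbT.
  have K1 := @wrap_par_insert _ _ [:: p] (map fst G) H1 u1 erefl
    ltac:(by rewrite inE eq_sym) (insert_jproof H1 sR1 u1 j1).
  have K2 := @wrap_par_insert _ _ [:: q] (map fst D) H2 u2 erefl
    ltac:(by rewrite inE eq_sym) (insert_jproof H2 sR2 u2 j2).
  have /and3P[hp hq _] : [&& p < n, q < n & r < n] by apply: LTens_lt;
    apply: sR; rewrite mem_head.
  rewrite /= erase_wrap_tens /= !erase_wrap_par IH1 ?IH2 ?(uniq_wrap_par v1) ?(uniq_wrap_par v2) //.
  rewrite (jproof_origin K1) ?(jproof_origin K2) ?back_graft //.
  + by apply: (jproof_edges K2); rewrite mem_head.
  + by apply: (jproof_edges K1); rewrite mem_head.
- rewrite edges_Par cons_uniq => /andP[_ u] /andP[jpi /implyP jpq] /uniq_wrap_tens.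
  rewrite edgesJE cons_uniq => /andP[_ v].
  have sR' : {subset deseq pi <= R} by move=> l h; apply: sR; rewrite /= inE h orbT.
  have K := @wrap_par_insert _ _ [:: p; q] (map fst G) H u erefl jpq
    (insert_jproof H sR' u jpi).
  have /and3P[hp hq _] : [&& p < n, q < n & r < n] by apply: LPar_lt; apply: sR;
    rewrite mem_head.
  rewrite /= erase_wrap_tens /= !erase_wrap_par IH ?(uniq_wrap_par v) //.
  by rewrite !(jproof_origin K) ?back_graft //; apply: (jproof_edges K);
    rewrite !inE eqxx ?orbT.
Qed.

(** * Projection and lifting of sequentializations *)

Lemma uniq_jgraph : uniq (edges R) -> uniq (edges jgraph).
Proof.
move=> uR; have -> : edges jgraph = [:: n; n.+1; n.+2; n.+3] ++ edges R.
  rewrite /jgraph !edges_cons; do 4 congr (_ :: _).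
  by rewrite /edges -map_comp; congr flatten; apply: eq_map; case.
rewrite cat_uniq uR andbT /= !inE; apply/andP; split; first by lia.
by apply/hasPn => e /edges_lt; rewrite /= !inE; lia.
Qed.

Lemma unlink_jgraph : pmap unlink jgraph = R.
Proof.
rewrite /= ifF ?ifF /=; try by lia.
have : {subset R <= R} by [].
elim: {1 3 4}R => //= l s IH sR.
rewrite unlink_jlink ?sR ?mem_head //= IH // => l' h.
by apply: sR; rewrite inE h orbT.
Qed.

Lemma erase_jgraph rho Gamma : uniq (edges R) -> mllJ rho Gamma ->
    perm_eq (deseqJ rho) jgraph ->
  [/\ exists Delta, mll (erase rho) Delta, perm_eq (deseq (erase rho)) R &
      jumpable F F' (erase rho)].
Proof.
move=> uR H E; have u : uniq (edges (deseqJ rho)).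
  by rewrite (perm_uniq (perm_edges E)) uniq_jgraph.
have [K _] := mllJ_jproof H (fun l h => etrans (esym (perm_mem E l)) h).
split; first by exists (erase_sequent rho Gamma); apply: erase_sound.
- by rewrite (jproof_deseq K u) -[X in perm_eq _ X]unlink_jgraph; apply: perm_pmap.
- exact: jproof_jumpable K u.
Qed.

(** The witness is [insert pi], closed by a par at the root in case [F'] is a conclusion. *)
Lemma lift_jgraph pi Gamma : F \in edges R -> F' \in edges R -> uniq (edges R) ->
    mll pi Gamma -> perm_eq (deseq pi) R -> jumpable F F' pi ->
  exists2 rho, (exists Delta, mllJ rho Delta) /\ perm_eq (deseqJ rho) jgraph &
    erase rho = pi.
Proof.
move=> FR F'R uR H E j; have pE := perm_edges E.
have u : uniq (edges (deseq pi)) by rewrite (perm_uniq pE).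
have eF : F \in edges (deseq pi) by rewrite (perm_mem pE).
have sR : {subset deseq pi <= R} by move=> l; rewrite (perm_mem E).
have pS := mll_edges H; have uS := u; rewrite (perm_uniq pS) in uS.
have uP : uniq (premises (deseq pi)) by move: uS; rewrite cat_uniq => /and3P[].
pose rho := wrap_par (map fst Gamma) (insert pi).
have Erho : perm_eq (deseqJ rho) jgraph.
  apply/permP => a; rewrite count_wrap_par count_insert // eF /=.
  (* [F'] is either used in [pi] or in its final sequent, never both, so the par is inserted exactly
     once. *)
  have := mem_cat_disjoint F' uS; rewrite -(perm_mem pS) (perm_mem pE) F'R.
  have /permP/(_ a) -> := perm_map jlink E.
  by case: (F' \in _) => /=; case: (F' \in _) => //= _; generalize_bools; lia.
have urho : uniq (edges (deseqJ rho)) by rewrite (perm_uniq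
  (perm_edges Erho)) uniq_jgraph.
exists rho; last by rewrite erase_wrap_par (erase_insert H) // (uniq_wrap_par urho).
split=> //.
have K := @wrap_par_insert _ _ (map fst Gamma) [::] H u (esym (cats0 _)) (fun=> eF)
  (insert_jproof H sR u j).
by have [Delta [m _ _]] := jproofP K; exists Delta.
Qed.

End Jump.

(** * Fresh names and the equality of the two sets *)

Lemma edges_fresh (X : eqType) (R : graph X) : {in edges R, forall e, e < fresh R}.
Proof. by move=> e eR; rewrite ltnS;
  apply: (@leq_bigmax_seq _ _ _ (fun e => e) e eR). Qed.

(** As [F] is below the fresh names, rerouting it leaves [n.+1] and [n.+3] alone, so the two
    successive reroutings compose into [graft]. *)
Lemma jumpE (X : eqType) (R : graph X) (F F' : nat) : F \in edges R ->
  jump F F' R = jgraph R F F' (fresh R).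
Proof.
move=> /edges_fresh FR.
have n1 : ((fresh R).+1 == F) = false by lia.
have n3 : ((fresh R).+3 == F) = false by lia.
rewrite /jump /jgraph /= n1 -!map_comp; congr [:: _, _, _ & _].
apply: eq_map => -[p q A|p q r|p q r] //=; rewrite /graft.
all: by case: (p == F'); case: (q == F'); rewrite /= ?n3.
Qed.

Theorem theorem3p5 (X : eqType) (R : graph X) (F F' : nat)
    (R_ps : proof_structure R) (F_in : F \in edges R) (F'_in : F' \in edges R) :
  @erase X @` seqnJ (jump F F' R) = seqn_above [set (F, F')] R.
Proof.
case: R_ps => uR _ pR _; rewrite jumpE //.
have lt := @edges_fresh X R; have ltF := lt _ F_in; have ltF' := lt _ F'_in.
apply/seteqP; split=> [_ [rho [[Gamma H] E] <-]|pi [[[Gamma H] E] /(_ F F' erefl) ab]].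
- have [[Delta K] Epi j] := erase_jgraph lt pR ltF ltF' uR H E.
  have pE := perm_edges Epi; split; first by split=> //; exists Delta.
  move=> _ _ [-> ->]; apply/(aboveP _ K); rewrite ?(perm_uniq pE) ?(perm_mem pE) //.
- have pE := perm_edges E.
  have /(aboveP _ H)[||_ j] := ab; rewrite ?(perm_uniq pE) ?(perm_mem pE) //.
  have [rho m <-] := lift_jgraph lt pR ltF ltF' F_in F'_in uR H E j.
  by exists rho.
Qed.
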